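(* Let $H$ be a separable infinite-dimensional complex Hilbert space. For every bounded self-adjoint operator $A$ on $H$ there exist real numbers $\alpha_1,\alpha_2,\alpha_3,\alpha_4$ and orthoprojections $P_1,P_2,P_3,P_4$ on $H$ such that $A=\alpha_1P_1+\alpha_2P_2+\alpha_3P_3+\alpha_4P_4$.
   Context: An orthoprojection on $H$ is a bounded operator $P$ on $H$ with $P=P^*=P^2$. *)

(* Defs.v *)
From HB Require Import structures.
From mathcomp Require Import all_boot all_order all_algebra.
From mathcomp Require Import complex.
From mathcomp Require Import all_classical all_reals all_analysis.

Set Implicit Arguments.
Unset Strict Implicit.
Unset Printing Implicit Defensive.

Import Order.TTheory GRing.Theory Num.Theory.
Import numFieldNormedType.Exports.

Local Open Scope classical_set_scope.
Local Open Scope ring_scope.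
Local Open Scope complex_scope.

(* A complex Hilbert space is a complete normed module H over the complex
   numbers R[i] together with an inner product
   [dot : {dot H for Num.conj}] (linear in the first variable,
   conjugate-linear in the second) that induces the norm of H. *)
Definition induces_norm (R : realType) (H : normedModType R[i])
    (dot : {dot H for @Num.conj R[i]}) : Prop :=
  forall x : H, `|x| = sqrtC (dot x x).

Definition separable (T : topologicalType) : Prop :=
  exists D : set T, countable D /\ dense D.

(* In the algebraic sense; [vectType] bundles a dimension, so it cannot be used
   to express this as a property of a module. *)
Definition finite_dimensional (K : fieldType) (V : lmodType K) : Prop :=
  exists (n : nat) (e : 'I_n -> V),
    forall x : V, exists c : 'I_n -> K, x = \sum_i c i *: e i.

Definition bounded_operator (R : realType) (H : normedModType R[i])
    (T : {linear H -> H}) : Prop :=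
  exists M : R, forall x : H, `|T x| <= M%:C * `|x|.

(* [is_adjoint dot T S] means S = T^*: an adjoint is unique when it exists,
   because [dot] is definite. *)
Definition is_adjoint (R : realType) (H : lmodType R[i])
    (dot : {dot H for @Num.conj R[i]}) (T S : {linear H -> H}) : Prop :=
  forall x y : H, dot (T x) y = dot x (S y).

Definition self_adjoint (R : realType) (H : lmodType R[i])
    (dot : {dot H for @Num.conj R[i]}) (T : {linear H -> H}) : Prop :=
  is_adjoint dot T T.

Definition orthoprojection (R : realType) (H : normedModType R[i])
    (dot : {dot H for @Num.conj R[i]}) (P : {linear H -> H}) : Prop :=
  [/\ bounded_operator P, self_adjoint dot P & forall x : H, P (P x) = P x].

(* Main.v *)
Require Import Defs.
From HB Require Import structures.
From mathcomp Require Import all_boot all_order all_algebra.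
From mathcomp Require Import complex ring lra.
From mathcomp Require Import all_classical all_reals all_analysis.

(** Split H into two orthogonal halves.  An operator N that exchanges the halves
    anticommutes with the symmetry J equal to 1 on one half and to -1 on the
    other.  If N is self-adjoint with norm at most 1/2 and S = sqrt(1 - N^2), then
    N + S J and -N + S J are self-adjoint involutions, so N is a difference of two
    orthoprojections ([offdiag_proj_sub]).  Hence it suffices to find alpha, beta
    and orthoprojections P1, P2 such that alpha P1 + beta P2 has the same two
    diagonal blocks as A: the remainder is gamma (P3 - P4) for a large gamma.

    The halves are chosen so that both diagonal blocks of A are diagonal matrices.
    H is exhausted by finite-dimensional pairwise orthogonal levels such that A
    maps each level into itself and its two neighbours; the halves are the spans
    of the even and of the odd levels, and a Hermitian matrix is diagonalized on
    each level ([tower]).  Let c be a value such that, orthogonally to any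
    finite set of vectors, some unit vector f has <A f, f> as close to c as wanted
    ([essential_value]).  Each level is given one good basis vector, whose diagonal
    coefficient is within 2^-n of c; the other basis vectors are uncontrolled.

    The basis vectors are then threaded into infinitely many two-sided paths
       ..., x_i, y_i, x_(i+1), y_(i+1), ...
    alternating between the halves, each containing at most two uncontrolled
    vectors ([double_paths]).  P1 projects onto the span of the unit vectors
    sqrt(t_i) x_i + sqrt(1 - t_i) y_i, and P2 onto the span of the unit vectors
    sqrt(s_i) y_i + sqrt(1 - s_i) x_(i+1).  Take alpha + beta = 2 c and write
    zeta_i = alpha (t_i - 1/2), xi_i = beta (s_i - 1/2).  If c + dx_i and c + dy_i
    are the diagonal coefficients of A, equality of the diagonal blocks means
       dx_i = zeta_i - xi_(i-1)   and   dy_i = xi_i - zeta_i.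
    The solutions are the partial sums of the dx and dy along the path.  These are
    bounded, because the deviations of the good vectors are summable
    ([bounded_walk]), so t_i and s_i lie in [0, 1] as soon as alpha and -beta are
    large enough ([four_proj_of_paths]).  The paths are two-sided since the free
    end of a one-sided path would prescribe one of the parameters. *)

Set Implicit Arguments.
Unset Strict Implicit.
Unset Printing Implicit Defensive.
Import Order.TTheory GRing.Theory Num.Theory.
Import numFieldNormedType.Exports.
Local Open Scope ring_scope.
Local Open Scope complex_scope.

(** * Index sets and bounded walks *)

Section Combinatorics.
Local Open Scope classical_set_scope.
Local Open Scope card_scope.
Local Open Scope ring_scope.

Lemma infinite_set_inj_seq (T : Type) (A : set T) (h : nat -> T) :
  injective h -> (forall n, A (h n)) -> infinite_set A.
Proof.
move=> hi hA; apply/infiniteP.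
have E : h @` [set: nat] #= [set: nat] by apply: inj_card_eq => ? ? _ _; apply: hi.
rewrite -(card_le_eql E); apply: subset_card_le => _ [n _ <-]; exact: hA.
Qed.

(** Both sets are equipotent to the set of natural numbers. *)
Lemma infinite_set_bij (T : countType) (U : pointedType) (A : set T) (B : set U) :
  countable B -> infinite_set A -> infinite_set B -> exists f, set_bij A B f.
Proof.
move=> cB iA iB; apply/card_set_bijP.
apply: card_eq_trans (eq_card_nat (countableP A) iA) _.
by rewrite card_eq_sym; exact: eq_card_nat.
Qed.

(** The pair (p, i) is position i on the two-sided path p.  Infinitely many paths
    can each be given one element of [B], at position 0, because [G] is
    equipotent to the set of all the remaining positions. *)
Lemma double_paths (B G : set (nat * nat)) :
  infinite_set B -> infinite_set G -> (forall v, B v -> G v -> False) ->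
  exists psi : nat * int -> nat * nat, [/\ injective psi,
    forall k, B (psi k) \/ G (psi k),
    forall v, B v \/ G v -> exists k, psi k = v &
    forall p i, i != 0 -> G (psi (p, i))].
Proof.
move=> iB iG BG.
have iI : infinite_set [set k : nat * int | k.2 != 0].
  by apply: (@infinite_set_inj_seq _ _ (fun n => (n, 1))) => // m n [].
have [f [fB fi fs]] := infinite_set_bij (countableP B) infinite_nat iB.
have [g [gG gi gs]] := infinite_set_bij (countableP G) iI iG.
exists (fun k => if k.2 == 0 then f k.1 else g k).
have fB' n : B (f n) by exact: fB.
have gG' k : k.2 != 0 -> G (g k) by exact: gG.
split.
- move=> [p i] [q j] /=; case: eqVneq => [->|i0]; case: eqVneq => [->|j0] e.
  + by congr (_, _); apply: fi; rewrite ?inE.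
  + by case: (BG (f p)) => //; rewrite e; exact: gG'.
  + by case: (BG (g (p, i))); [rewrite e|exact: gG'].
  + by apply: gi; rewrite ?inE.
- by move=> [p i] /=; case: eqVneq => i0; [left|right; exact: gG'].
- move=> v [/fs[p _ <-]|/gs[k k0 <-]]; first by exists (p, 0); rewrite eqxx.
  by exists k; rewrite (negPf k0).
- by move=> p i i0 /=; rewrite (negPf i0); exact: gG'.
Qed.

(** Distinct exponents give distinct terms of the geometric series of sum 2. *)
Lemma sum_half_pow_uniq (R : realFieldType) (s : seq nat) :
  uniq s -> \sum_(k <- s) (2^-1 : R) ^+ k <= 2.
Proof.
(* compare with the sum over all exponents below N *)
move=> us; pose N := (\max_(k <- s) k).+1.
have sN : perm_eq s [seq k <- iota 0 N | k \in s].
  apply: uniq_perm => // [|k]; first by rewrite filter_uniq ?iota_uniq.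
  rewrite mem_filter mem_iota add0n; case ks : (k \in s) => //=.
  by rewrite ltnS; apply/esym; exact: leq_bigmax_seq.
rewrite (perm_big _ sN) big_filter big_mkcond /=.
have p0 k : 0 <= (2^-1 : R) ^+ k by rewrite exprn_ge0 ?invr_ge0.
apply: (@le_trans _ _ (\sum_(k <- iota 0 N) (2^-1 : R) ^+ k)).
  by apply: ler_sum => k _; case: ifP.
suff -> n : \sum_(k <- iota 0 n) (2^-1 : R) ^+ k = 2 - 2 * 2^-1 ^+ n.
  by have := p0 N; lra.
elim: n => [|n IH]; first by rewrite big_nil expr0; lra.
by rewrite -addn1 iotaD big_cat /= big_seq1 IH add0n addn1 exprS; lra.
Qed.

(** Position 0 contributes at most [D]; the other terms are dominated by distinct
    powers of 1/2. *)
Lemma sum_path_bound (R : realFieldType) (d : int -> R) (l : int -> nat) (D : R)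
    (e : nat -> int) (n : nat) :
  0 <= D -> (forall i, `|d i| <= D) -> (forall i, i != 0 -> `|d i| <= 2^-1 ^+ l i) ->
  (forall i j, i != 0 -> j != 0 -> l i = l j -> i = j) -> injective e ->
  `|\sum_(k < n) d (e k)| <= D + 2.
Proof.
move=> D0 dD dl li ei; apply: le_trans (ler_norm_sum _ _ _) _.
rewrite -(big_mkord xpredT (fun k => `|d (e k)|)) /index_iota subn0.
rewrite -(big_map e xpredT (fun i => `|d i|)); set s := map e _.
have us : uniq s by rewrite map_inj_uniq ?iota_uniq.
rewrite (bigID (pred1 0)) /=; apply: lerD.
  apply: le_trans (ler_sum _ (fun i _ => dD i)) _.
  rewrite big_const_seq iter_addr_0 count_uniq_mem //.
  by case: (_ \in _); rewrite ?mulr1n ?mulr0n.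
apply: le_trans (ler_sum _ (fun i i0 => dl i i0)) _.
rewrite -big_filter -(big_map l xpredT (fun k => 2^-1 ^+ k)).
apply: sum_half_pow_uniq; rewrite map_inj_in_uniq ?filter_uniq // => i j.
by rewrite !mem_filter => /andP[i0 _] /andP[j0 _]; exact: li.
Qed.

(** A discrete primitive on the integers vanishing at -1; [Negz k] is -(k + 1), so
    its values on the negative side are the opposites of the sums over [Negz]. *)
Lemma int_primitive (R : realFieldType) (d : int -> R) (K : R) :
  (forall n, `|\sum_(k < n) d (Posz k)| <= K) ->
  (forall n, `|\sum_(k < n) d (Negz k)| <= K) ->
  exists xi : int -> R, forall i, d i = xi i - xi (i - 1) /\ `|xi i| <= K.
Proof.
move=> dp dn.
exists (fun i => match i with
  | Posz k => \sum_(j < k.+1) d (Posz j) | Negz k => - \sum_(j < k) d (Negz j) end).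
move=> [[|k]|k]; split; rewrite ?normrN //.
- by rewrite sub0r -[- 1]/(Negz 0) big_ord1 big_ord0 oppr0 subr0.
- have -> : Posz k.+1 - 1 = Posz k by rewrite intS addrC addKr.
  by rewrite [in RHS]big_ord_recr /= addrAC subrr add0r.
have -> : Negz k - 1 = Negz k.+1 by rewrite !NegzE [in RHS]intS opprD addrC.
by rewrite [X in _ = _ - - X]big_ord_recr /= opprK addrA addNr add0r.
Qed.

(** The recursion along a path has [dx + dy] as the increments of [xi]; [zeta] is the
    intermediate value between two steps. *)
Lemma bounded_walk (R : realFieldType) (dx dy : nat * int -> R)
    (lx ly : nat * int -> nat) (D : R) :
  0 <= D -> (forall k, `|dx k| <= D) -> (forall k, `|dy k| <= D) ->
  (forall p i, i != 0 -> `|dx (p, i)| <= 2^-1 ^+ lx (p, i)) ->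
  (forall p i, i != 0 -> `|dy (p, i)| <= 2^-1 ^+ ly (p, i)) ->
  (forall p i j, i != 0 -> j != 0 -> lx (p, i) = lx (p, j) -> i = j) ->
  (forall p i j, i != 0 -> j != 0 -> ly (p, i) = ly (p, j) -> i = j) ->
  exists (K : R) (zeta xi : nat * int -> R), [/\
    forall k, dx k = zeta k - xi (k.1, k.2 - 1), forall k, dy k = xi k - zeta k,
    forall k, `|zeta k| <= K & forall k, `|xi k| <= K].
Proof.
move=> D0 dxD dyD dxl dyl lxi lyi.
have bnd p (e : nat -> int) n : injective e ->
    `|\sum_(k < n) (dx (p, e k) + dy (p, e k))| <= (D + 2) + (D + 2).
  move=> ei; rewrite big_split /=; apply: le_trans (ler_normD _ _) _; apply: lerD.
    by apply: (@sum_path_bound _ (fun i => dx (p, i)) (fun i => lx (p, i))); auto; exact: lxi.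
  by apply: (@sum_path_bound _ (fun i => dy (p, i)) (fun i => ly (p, i))); auto; exact: lyi.
have /(_ _)/cid-/all_sig[xi xiP] p : exists xi : int -> R, forall i,
    dx (p, i) + dy (p, i) = xi i - xi (i - 1) /\ `|xi i| <= (D + 2) + (D + 2).
  by apply: int_primitive => n; apply: bnd => a b [].
exists ((D + 2) + (D + 2) + D), (fun k => xi k.1 (k.2 - 1) + dx k), (fun k => xi k.1 k.2).
split=> [[p i]|[p i]|[p i]|[p i]] /=.
- by rewrite addrAC subrr add0r.
- by have [+ _] := xiP p i; lra.
- apply: le_trans (ler_normD _ _) _; apply: lerD (dxD _).
  by have [] := xiP p (i - 1).
- by have [_ +] := xiP p i; lra.
Qed.

End Combinatorics.

Section HilbertSpace.
Local Open Scope classical_set_scope.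
Local Open Scope ring_scope.
Local Open Scope complex_scope.
Variables (R : realType) (H : completeNormedModType R[i]).
Variables (dot : {dot H for @Num.conj R[i]}) (Hdot : induces_norm dot).
Implicit Types (x y z : H) (a b : R[i]).
Local Notation "x ^*" := (@Num.conj R[i] x).
Local Notation "'[ x , y ]" := (dot x y) : ring_scope.

(** * Inner product and norm *)

Lemma dotDl x y z : '[x + y, z] = '[x, z] + '[y, z].
Proof. exact: linearDl. Qed.
Lemma dotDr x y z : '[z, x + y] = '[z, x] + '[z, y].
Proof. exact: linearD. Qed.
Lemma dotNl x y : '[- x, y] = - '[x, y].
Proof. exact: linearNl. Qed.
Lemma dotBl x y z : '[x - y, z] = '[x, z] - '[y, z].
Proof. exact: linearBl. Qed.
Lemma dotBr x y z : '[z, x - y] = '[z, x] - '[z, y].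
Proof. exact: linearB. Qed.
Lemma dotZl a x y : '[a *: x, y] = a * '[x, y].
Proof. exact: linearZl_LR. Qed.
Lemma dotZr a x y : '[x, a *: y] = a^* * '[x, y].
Proof. exact: linearZr_LR. Qed.
Lemma dot0l x : '[0, x] = 0.
Proof. exact: (linear0l dot). Qed.
Lemma dot0r x : '[x, 0] = 0.
Proof. exact: linear0r. Qed.
Lemma dotC x y : '[x, y] = '[y, x]^*.
Proof. by have := @hermitian_subproof _ _ _ _ dot x y; rewrite expr0 mul1r. Qed.
Lemma dot_suml (I : Type) (r : seq I) (P : pred I) (F : I -> H) y :
  '[\sum_(i <- r | P i) F i, y] = \sum_(i <- r | P i) '[F i, y].
Proof. exact: linear_sumlz. Qed.
Lemma dot_sumr (I : Type) (r : seq I) (P : pred I) (F : I -> H) y :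
  '[y, \sum_(i <- r | P i) F i] = \sum_(i <- r | P i) '[y, F i].
Proof. exact: linear_sum. Qed.
Lemma dotZrr (r : R) x y : '[x, r%:C *: y] = r%:C * '[x, y].
Proof. by rewrite dotZr; congr (_ * _); exact: conjc_real. Qed.

Lemma dot_sym0 x y : '[x, y] = 0 -> '[y, x] = 0.
Proof. by rewrite dotC => /eqP; rewrite conjC_eq0 => /eqP. Qed.

(** The main tool for vector identities: it turns them into ring identities between
    scalars. *)
Lemma dot_ext x y : (forall z, '[x, z] = '[y, z]) -> x = y.
Proof.
move=> xy; apply/eqP; rewrite -subr_eq0 -(dnorm_eq0 dot); apply/eqP.
by rewrite /= dotBl xy subrr.
Qed.

(** The norm of H takes values in R[i]; its real part carries the same information
    and allows real arithmetic. *)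
Definition nrm x : R := complex.Re `|x|.

Lemma nrmE x : `|x| = (nrm x)%:C.
Proof. by rewrite RRe_real ?normr_real. Qed.

Lemma nrm_ge0 x : 0 <= nrm x.
Proof. by rewrite -lecR -nrmE normr_ge0. Qed.

Lemma nrm_eq0 x : nrm x = 0 -> x = 0.
Proof. by move=> n0; apply/eqP; rewrite -normr_eq0 nrmE n0. Qed.

Lemma nrm0 : nrm 0 = 0.
Proof. by rewrite /nrm normr0. Qed.

Lemma nrmD x y : nrm (x + y) <= nrm x + nrm y.
Proof. by have := ler_normD x y; rewrite !nrmE -rmorphD lecR. Qed.

Lemma nrmN x : nrm (- x) = nrm x.
Proof. by rewrite /nrm normrN. Qed.

Lemma nrm_distC x y : nrm (x - y) = nrm (y - x).
Proof. by rewrite -nrmN opprB. Qed.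

Definition cabs a : R := complex.Re `|a|.

Lemma cabsE a : `|a| = (cabs a)%:C.
Proof. by rewrite RRe_real ?normr_real. Qed.

Lemma cabs_ge0 a : 0 <= cabs a.
Proof. by rewrite -lecR -cabsE normr_ge0. Qed.

Lemma cabs0 : cabs 0 = 0.
Proof. by rewrite /cabs normr0. Qed.

Lemma cabs_eq0 a : cabs a = 0 -> a = 0.
Proof. by move=> n0; apply/eqP; rewrite -normr_eq0 cabsE n0. Qed.

Lemma cabsD a b : cabs (a + b) <= cabs a + cabs b.
Proof. by have := ler_normD a b; rewrite !cabsE -rmorphD lecR. Qed.

Lemma cabsN a : cabs (- a) = cabs a.
Proof. by rewrite /cabs normrN. Qed.

Lemma cabsR (r : R) : cabs r%:C = `|r|.
Proof. by rewrite /cabs normc_def /= expr0n addr0 sqrtr_sqr. Qed.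

Lemma nrmZ a x : nrm (a *: x) = cabs a * nrm x.
Proof. by apply: complexI; rewrite -nrmE normrZ cabsE nrmE rmorphM. Qed.

Lemma nrmZr (r : R) x : nrm (r%:C *: x) = `|r| * nrm x.
Proof. by rewrite nrmZ cabsR. Qed.

Lemma dotxx x : '[x, x] = (nrm x ^+ 2)%:C.
Proof. by rewrite rmorphXn /= -nrmE Hdot sqrtCK. Qed.

(** The square norm of the component of [x] orthogonal to [y], multiplied by the
    square norm of [y], is nonnegative. *)
Lemma cauchy_schwarz x y : cabs '[x, y] <= nrm x * nrm y.
Proof.
have [y0|yn0] := eqVneq (nrm y) 0.
  by rewrite (nrm_eq0 y0) dot0r cabs0 nrm0 mulr0.
have y2 : '[y, y] != 0.
  by rewrite dotxx; apply/eqP => -[] /eqP; rewrite expf_eq0 (negPf yn0) andbF.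
pose t := '[x, y] / '[y, y].
have h : '[x - t *: y, x - t *: y] * '[y, y] = '[x, x] * '[y, y] - '[x, y] * '[x, y]^*.
  have tJ : t^* = '[x, y]^* / '[y, y].
    by rewrite /t rmorphM fmorphV /= -(dotC y y).
  rewrite !dotBl !dotBr !dotZl !dotZr tJ /t (dotC y x).
  rewrite -(dotC y x).
  have key (a b c d : R[i]) : d != 0 ->
    (a - c / d * b - (b / d * c - b / d * (c / d * d))) * d = a * d - b * c.
    by move=> d0; field.
  exact: key.
have : 0 <= '[x - t *: y, x - t *: y] * '[y, y] by apply: mulr_ge0; exact: (dnorm_ge0 dot).
rewrite h -normCK !dotxx cabsE -rmorphXn -rmorphM -rmorphB ler0c subr_ge0 -exprMn.
by rewrite ler_pXn2r // nnegrE ?mulr_ge0 ?nrm_ge0 ?cabs_ge0.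
Qed.

Definition converges_to (u : nat -> H) (l : H) :=
  forall e : R, 0 < e -> exists N, forall n, (N <= n)%N -> nrm (u n - l) < e.

Lemma nrm_complete (u : nat -> H) :
  (forall e : R, 0 < e -> exists N, forall m n, (N <= m)%N -> (m <= n)%N -> nrm (u m - u n) < e) ->
  exists l, converges_to u l.
Proof.
move=> cu.
have : cauchy (u @ \oo).
  apply: cauchy_exP => e e0.
  have eE : e = (complex.Re e)%:C by rewrite RRe_real // gtr0_real.
  have re0 : 0 < complex.Re e by rewrite -ltcR -eE.
  have [N hN] := cu _ re0.
  exists (u N), N => // n /= Nn.
  by rewrite -ball_normE /= nrmE eE ltcR hN.
move=> /cauchy_cvgP cv; exists (lim (u @ \oo)) => e e0.
have e0C : 0 < e%:C by rewrite ltcR.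
have /cvgrPdist_lt /(_ _ e0C) [N _ hN] := cv.
by exists N => n Nn; have := hN n Nn; rewrite /= nrmE ltcR nrm_distC.
Qed.

(** * Limits and self-adjoint maps *)

Lemma limit_unique (u : nat -> H) l l' : converges_to u l -> converges_to u l' -> l = l'.
Proof.
move=> ul ul'; apply/eqP; rewrite -subr_eq0; apply/eqP/nrm_eq0.
apply/eqP; rewrite eq_le nrm_ge0 andbT leNgt; apply/negP => e0.
have e20 : 0 < nrm (l - l') / 2 by rewrite divr_gt0.
have [N hN] := ul _ e20; have [N' hN'] := ul' _ e20.
have := hN _ (leq_maxl N N'); have := hN' _ (leq_maxr N N').
set m := maxn N N'; move=> h1 h2.
have : nrm (l - l') <= nrm (u m - l) + nrm (u m - l').
  rewrite (nrm_distC (u m) l); apply: le_trans (nrmD _ _).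
  by rewrite addrA subrK.
lra.
Qed.

Lemma limit_ext (u v : nat -> H) l : (forall n, u n = v n) -> converges_to u l -> converges_to v l.
Proof.
by move=> uv ul e /ul[N hN]; exists N => n /hN; rewrite uv.
Qed.

Lemma limit_shift (u : nat -> H) l : converges_to u l -> converges_to (fun n => u n.+1) l.
Proof.
by move=> ul e /ul[N hN]; exists N => n Nn; apply: hN; apply: leqW.
Qed.

Lemma limit_near_cst (u : nat -> H) l N :
  (forall n, (N <= n)%N -> u n = l) -> converges_to u l.
Proof. by move=> ul e e0; exists N => n /ul->; rewrite subrr nrm0. Qed.

Lemma limitD (u v : nat -> H) l l' :
  converges_to u l -> converges_to v l' -> converges_to (fun n => u n + v n) (l + l').
Proof.
move=> ul vl e e0; have e20 : 0 < e / 2 by rewrite divr_gt0.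
have [N hN] := ul _ e20; have [N' hN'] := vl _ e20.
exists (maxn N N') => n; rewrite geq_max => /andP[/hN h1 /hN' h2].
rewrite opprD addrACA; apply: le_lt_trans (nrmD _ _) _.
lra.
Qed.

Lemma limit_lipschitz (f : H -> H) (M : R) (u : nat -> H) l :
  (forall x y, nrm (f x - f y) <= M * nrm (x - y)) ->
  converges_to u l -> converges_to (fun n => f (u n)) (f l).
Proof.
move=> fM ul e e0.
have M0 : 0 < `|M| + 1 by rewrite ltr_wpDl.
have [|N hN] := ul (e / (`|M| + 1)); first by rewrite divr_gt0.
exists N => n /hN; rewrite ltr_pdivlMr // => h.
apply: le_lt_trans (fM _ _) _; apply: le_lt_trans h.
rewrite mulrC ler_wpM2l ?nrm_ge0 //; have := ler_norm M; lra.
Qed.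

(** The form is continuous in each variable, by the Cauchy-Schwarz inequality.  Stated
    this way, it transfers self-adjointness from approximants to their limits. *)
Lemma limit_dot (u v : nat -> H) l l' y z : converges_to u l -> converges_to v l' ->
  (forall n, '[u n, z] = '[y, v n]) -> '[l, z] = '[y, l'].
Proof.
move=> ul vl uv; apply/eqP; rewrite -subr_eq0; apply/eqP/cabs_eq0.
apply/eqP; rewrite eq_le cabs_ge0 andbT; apply/ler_addgt0Pr => e e0.
pose K := nrm z + nrm y + 1.
have K0 : 0 < K by rewrite ltr_wpDl ?addr_ge0 ?nrm_ge0.
have eK : 0 < e / K by rewrite divr_gt0.
have [N hN] := ul _ eK; have [N' hN'] := vl _ eK.
have := hN _ (leq_maxl N N'); have := hN' _ (leq_maxr N N').
set m := maxn N N' => h1 h2.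
have -> : '[l, z] - '[y, l'] = '[y, v m - l'] - '[u m - l, z].
  by rewrite dotBl dotBr uv; ring.
apply: le_trans (cabsD _ _) _; rewrite cabsN add0r.
have c1 := cauchy_schwarz y (v m - l').
have c2 := cauchy_schwarz (u m - l) z.
apply: le_trans (lerD c1 c2) _.
have := ler_wpM2l (nrm_ge0 y) (ltW h1); have := ler_wpM2r (nrm_ge0 z) (ltW h2).
have eKK : e = e / K * K by rewrite mulfVK ?gt_eqF.
have : 0 <= e / K by exact: ltW.
rewrite [X in _ -> _ -> _ -> _ <= X]eKK /K.
have := nrm_ge0 z; have := nrm_ge0 y.
set q := e / _; nra.
Qed.

(** The increments have a convergent sum, so the sequence is Cauchy. *)
Lemma limit_geometric (u : nat -> H) (C : R) :
  (forall n, nrm (u n.+1 - u n) <= C * 2^-1 ^+ n) -> exists l, converges_to u l.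
Proof.
move=> uC.
have C0 : 0 <= C by have := uC 0%N; rewrite expr0 mulr1; apply: le_trans; exact: nrm_ge0.
have tail n k : nrm (u (n + k)%N - u n) <= 2 * C * (2^-1 ^+ n - 2^-1 ^+ (n + k)).
  elim: k => [|k IH]; first by rewrite addn0 !subrr nrm0 mulr0.
  have -> : u (n + k.+1)%N - u n = (u (n + k).+1 - u (n + k)%N) + (u (n + k)%N - u n).
    by rewrite addrA subrK addnS.
  apply: le_trans (nrmD _ _) _; apply: le_trans (lerD (uC _) IH) _.
  rewrite addnS exprS; set p := _ ^+ (n + k); lra.
apply: nrm_complete => e e0.
have h2 : `|2^-1 : R| < 1 by rewrite gtr0_norm ?invr_gt0 // invf_lt1 // ltr1n.
have := @cvg_expr R 2^-1 h2 => /cvgrPdist_lt /(_ (e / (2 * C + 1))).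
have K0 : 0 < 2 * C + 1 by lra.
move=> /(_ (divr_gt0 e0 K0)) [N _ hN]; exists N => m n Nm mn.
rewrite nrm_distC -(subnKC mn); apply: le_lt_trans (tail _ _) _.
have := hN m Nm; rewrite /= sub0r normrN ger0_norm ?exprn_ge0 ?invr_ge0 //.
rewrite ltr_pdivlMr //.
have : 0 <= (2^-1 : R) ^+ m by rewrite exprn_ge0 ?invr_ge0.
have : 0 <= (2^-1 : R) ^+ (m + (n - m)) by rewrite exprn_ge0 ?invr_ge0.
set p := _ ^+ (m + _); set q := _ ^+ m; nra.
Qed.

(** Self-adjointness is required of bare functions, since it already implies
    linearity; operators can then be built as pointwise limits, and linear
    structures are only needed for the final statement. *)
Definition selfadj (f : H -> H) := forall x y, '[f x, y] = '[x, f y].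
Definition bounded_by (M : R) (f : H -> H) := forall x, nrm (f x) <= M * nrm x.

(** Test against an arbitrary vector and move [f] to the other side. *)
Lemma selfadjD f x y : selfadj f -> f (x + y) = f x + f y.
Proof. by move=> sf; apply: dot_ext => z; rewrite sf !dotDl !sf. Qed.

Lemma selfadjZ f a x : selfadj f -> f (a *: x) = a *: f x.
Proof. by move=> sf; apply: dot_ext => z; rewrite sf !dotZl !sf. Qed.

Lemma selfadjN f x : selfadj f -> f (- x) = - f x.
Proof. by move=> sf; rewrite -scaleN1r selfadjZ // scaleN1r. Qed.

Lemma selfadjB f x y : selfadj f -> f (x - y) = f x - f y.
Proof. by move=> sf; rewrite selfadjD // selfadjN. Qed.

Lemma selfadj_cont f M u l : selfadj f -> bounded_by M f ->
  converges_to u l -> converges_to (fun n => f (u n)) (f l).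
Proof.
move=> sf bf; apply: (@limit_lipschitz f M) => x y; rewrite -selfadjB //; exact: bf.
Qed.

(** * Square roots and off-diagonal operators *)

Definition proj (P : H -> H) := selfadj P /\ forall x, P (P x) = P x.

(** The fixed point [T] of [T |-> (N^2 + T^2) / 2] satisfies [(1 - T)^2 = 1 - N^2].
    Iterating from 0 replaces a functional calculus. *)
Fixpoint sqrt_iter (N : H -> H) (n : nat) (x : H) : H :=
  if n is n'.+1 then
    (2^-1)%:C *: (N (N x) + sqrt_iter N n' (sqrt_iter N n' x))
  else 0.

Lemma selfadj_sqrt_iter N n : selfadj N -> selfadj (sqrt_iter N n).
Proof.
move=> sN; elim: n => [|n IH] x y /=; first by rewrite dot0l dot0r.
by rewrite dotZl dotZrr dotDl dotDr !sN !IH.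
Qed.

(** The ball of radius 1/4 is preserved since (1/4 + 1/16) / 2 is at most 1/4. *)
Lemma bounded_sqrt_iter N n : bounded_by 2^-1 N -> bounded_by 4^-1 (sqrt_iter N n).
Proof.
move=> bN; elim: n => [|n IH] x /=.
  by rewrite nrm0 mulr_ge0 ?invr_ge0 ?nrm_ge0.
rewrite nrmZr gtr0_norm ?invr_gt0 //.
have h := nrmD (N (N x)) (sqrt_iter N n (sqrt_iter N n x)).
have := bN (N x); have := bN x.
have := IH x; have := IH (sqrt_iter N n x).
have := nrm_ge0 x.
lra.
Qed.

(** With [T] and [S] consecutive iterates, [T^2 - S^2 = T (T - S) + (T - S) S], where
    both outer factors have norm at most 1/4; the differences decay geometrically. *)
Lemma sqrt_iter_step N n x : selfadj N -> bounded_by 2^-1 N ->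
  nrm (sqrt_iter N n.+1 x - sqrt_iter N n x) <= nrm x * 2^-1 ^+ n.
Proof.
move=> sN bN; elim: n x => [|n IH] x.
  rewrite expr0 mulr1 subr0; apply: le_trans (@bounded_sqrt_iter N 1 bN x) _.
  have := nrm_ge0 x; lra.
set T := sqrt_iter N n.+1; set S := sqrt_iter N n in IH *.
have sT : selfadj T by exact: selfadj_sqrt_iter.
have -> : sqrt_iter N n.+2 x - T x =
    (2^-1)%:C *: (T (T x - S x) + (T (S x) - S (S x))).
  rewrite [in LHS]/T /= -/S -/T -scalerBr (selfadjB _ _ sT) -[_ + S (S x)]/(_ + _).
  by congr (_ *: _); rewrite opprD addrACA subrr add0r addrA subrK.
rewrite nrmZr gtr0_norm ?invr_gt0 //.
have h1 := @bounded_sqrt_iter N n.+1 bN (T x - S x).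
have h2 := IH x; have h3 := IH (S x); have h4 := @bounded_sqrt_iter N n bN x.
have h5 := nrmD (T (T x - S x)) (T (S x) - S (S x)).
rewrite -/T -/S in h1 h2 h3 h4 *.
have p0 : 0 <= (2^-1 : R) ^+ n by rewrite exprn_ge0 ?invr_ge0.
rewrite exprS; set p := _ ^+ n in p0 h2 h3 *.
have x0 := nrm_ge0 x.
have : nrm (S x) * p <= 4^-1 * nrm x * p by exact: ler_wpM2r.
have : 0 <= nrm x * p by exact: mulr_ge0.
lra.
Qed.

(** All iterates are polynomials in [N^2], so their limit commutes with every
    bounded self-adjoint map that commutes with [N^2]. *)
Lemma sqrt_one_sub_sqr N : selfadj N -> bounded_by 2^-1 N ->
  exists S : H -> H, [/\ selfadj S, forall x, S (S x) = x - N (N x) &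
    forall f M, selfadj f -> bounded_by M f -> (forall x, f (N (N x)) = N (N (f x))) ->
      forall x, f (S x) = S (f x)].
Proof.
move=> sN bN; pose T := sqrt_iter N.
have sT n : selfadj (T n) by exact: selfadj_sqrt_iter.
have bT n : bounded_by 4^-1 (T n) by exact: bounded_sqrt_iter.
have /(_ _)/cid-/all_sig[L LP] x : exists l, converges_to (T ^~ x) l.
  by apply: (limit_geometric (C := nrm x)) => n; exact: sqrt_iter_step.
have sL : selfadj L.
  by move=> x y; apply: (limit_dot (LP x) (LP y)) => n; exact: sT.
have TT x : converges_to (fun n => T n (T n x)) (L (L x)).
  have /limitD/(_ (LP (L x))) h : converges_to (fun n => T n (T n x - L x)) 0.
    move=> e e0; have [N' hN] := LP x e e0; exists N' => n Nn; rewrite subr0.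
    apply: le_lt_trans (bT n _) _; have := hN n Nn; have := nrm_ge0 (T n x - L x).
    lra.
  rewrite add0r in h; apply: limit_ext h => n.
  by rewrite (selfadjB _ _ (sT n)) subrK.
have LE x : L x = (2^-1)%:C *: (N (N x) + L (L x)).
  apply: (limit_unique (limit_shift (LP x))).
  have h : converges_to (fun n => N (N x) + T n (T n x)) (N (N x) + L (L x)).
    by apply: limitD (TT x); exact: (@limit_near_cst _ _ 0%N).
  apply: (limit_lipschitz (f := fun y => (2^-1)%:C *: y) (M := 2^-1) _ h) => y z.
  by rewrite -scalerBr nrmZr gtr0_norm // invr_gt0.
have LL x : L (L x) = L x + L x - N (N x).
  have -> : L x + L x = N (N x) + L (L x).
    rewrite {1 2}(LE x) -scalerDl -rmorphD /=.
    have -> : 2^-1 + 2^-1 = 1 :> R by lra.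
    by rewrite scale1r.
  by rewrite addrAC subrr add0r.
have fT f n : selfadj f -> (forall x, f (N (N x)) = N (N (f x))) ->
    forall x, f (T n x) = T n (f x).
  move=> sf fN; elim: n => [|n IH] x; first by rewrite /T /= -(subrr (0 : H)) (selfadjB _ _ sf) !subrr.
  by rewrite /T /= -/(T n) (selfadjZ _ _ sf) (selfadjD _ _ sf) fN !IH.
exists (fun x => x - L x); split.
- by move=> x y; rewrite dotBl dotBr sL.
- move=> x; rewrite (selfadjB _ _ sL) LL; apply: dot_ext => z.
  by rewrite !(dotBl, dotDl); ring.
- move=> f M sf bf fN x; rewrite (selfadjB _ _ sf); congr (_ - _).
  apply: (limit_unique (selfadj_cont sf bf (LP x))).
  by apply: limit_ext (LP (f x)) => n; rewrite fT.
Qed.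

Lemma proj_half_symmetry U : selfadj U -> (forall x, U (U x) = x) ->
  proj (fun x => (2^-1)%:C *: (x + U x)).
Proof.
move=> sU UU; split=> [x y|x]; first by rewrite dotZl dotZrr dotDl dotDr sU.
rewrite (selfadjZ _ _ sU) (selfadjD _ _ sU) UU (addrC (U x) x) -scalerDl -rmorphD /=.
have -> : 2^-1 + 2^-1 = 1 :> R by lra.
by rewrite scale1r.
Qed.

(** By Cauchy-Schwarz, since |P x|^2 = <P x, x>. *)
Lemma proj_contraction P : proj P -> bounded_by 1 P.
Proof.
move=> [sP PP] x; rewrite mul1r.
have [p0|pn0] := eqVneq (nrm (P x)) 0; first by rewrite p0 nrm_ge0.
have : nrm (P x) ^+ 2 <= nrm (P x) * nrm x.
  have := cauchy_schwarz (P x) x.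
  by rewrite -{1}PP sP dotxx // cabsR ger0_norm // exprn_ge0 ?nrm_ge0.
by rewrite expr2 ler_pM2l // lt_def pn0 nrm_ge0.
Qed.

(** The hypothesis says that [N] is off-diagonal for the decomposition given by [Q].
    Then [J = 2 Q - 1] anticommutes with [N] and commutes with the square root [S]
    of [1 - N^2], so the square of [s N + S J] is 1 for [s = 1] and [s = -1].  The
    two resulting projections differ by [N]. *)
Lemma offdiag_proj_sub N Q : selfadj N -> bounded_by 2^-1 N -> proj Q ->
  (forall x, N x = N (Q x) + Q (N x)) ->
  exists P P', [/\ proj P, proj P' & forall x, N x = P x - P' x].
Proof.
move=> sN bN pQ NQ; have [sQ QQ] := pQ.
have [S [sS SS Sf]] := sqrt_one_sub_sqr sN bN.
pose J x := Q x + Q x - x.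
have sJ : selfadj J by move=> x y; rewrite /J !dotBl !dotBr !dotDl !dotDr !sQ.
have bJ : bounded_by 3 J.
  move=> x; rewrite /J; have h1 := nrmD (Q x + Q x) (- x); have h2 := nrmD (Q x) (Q x).
  have := proj_contraction pQ x; rewrite nrmN in h1; lra.
have JJ x : J (J x) = x.
  rewrite /J (selfadjB _ _ sQ) (selfadjD _ _ sQ) QQ; apply: dot_ext => z.
  by rewrite !(dotBl, dotDl); ring.
have NJ x : N (J x) = - J (N x).
  rewrite /J (selfadjB _ _ sN) (selfadjD _ _ sN); apply: dot_ext => z.
  have -> : N (Q x) = N x - Q (N x) by rewrite {1}(NQ x) addrK.
  by rewrite !(dotNl, dotBl, dotDl); ring.
(* J is used below only through these identities; rewriting must not unfold it *)
clearbody J.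
have JS x : J (S x) = S (J x).
  by apply: (Sf _ _ sJ bJ) => y; rewrite NJ (selfadjN _ sN) NJ opprK.
have NS x : N (S x) = S (N x) by exact: (Sf _ _ sN bN).
pose U (s : R) x := s%:C *: N x + S (J x).
have sU s : selfadj (U s).
  by move=> x y; rewrite /U dotDl dotDr dotZl dotZrr sN sS sJ JS.
have UU s : s * s = 1 -> forall x, U s (U s x) = x.
  move=> ss x; rewrite /U.
  rewrite !(selfadjD _ _ sN, selfadjZ _ _ sN, selfadjD _ _ sJ, selfadjZ _ _ sJ,
    selfadjD _ _ sS, selfadjZ _ _ sS).
  rewrite NS NJ (selfadjN _ sS) JS SS JJ; apply: dot_ext => z.
  rewrite !(dotDl, dotZl, dotNl, dotBl) mulrDr mulrA -rmorphM ss.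
  by ring.
exists (fun x => (2^-1)%:C *: (x + U 1 x)), (fun x => (2^-1)%:C *: (x + U (-1) x)).
split; try by apply: proj_half_symmetry => //; apply: UU; rewrite ?mulrNN mulr1.
move=> x; apply: dot_ext => z.
rewrite /U !(dotDl, dotNl, dotZl) rmorphN rmorph1 fmorphV rmorph_nat.
by field.
Qed.

(** * Projections onto orthonormal families *)

Section PartialSums.
Variables (I : countType) (v : I -> H).
Hypothesis von : forall i j, '[v i, v j] = (i == j)%:R.

(** The family enumerated along the codes of its indices; a number that is not a
    code gets 0, which is harmless in a Fourier sum. *)
Let w (n : nat) : H := oapp v 0 (pickle_inv n).

Let w_pickle i : w (pickle i) = v i.
Proof. by rewrite /w pickleK_inv. Qed.

Let w_cases n : (exists2 i, n = pickle i & w n = v i) \/ w n = 0.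
Proof.
rewrite /w; case E: (pickle_inv n) => [i|]; last by right.
left; exists i => //; have := @pickle_invK I n; by rewrite E.
Qed.

Let w_orth m n : m != n -> '[w m, w n] = 0.
Proof.
move=> mn; have [[i ei ->]|->] := w_cases m; last by rewrite dot0l.
have [[j ej ->]|->] := w_cases n; last by rewrite dot0r.
by rewrite von; case: eqP => // eij; move: mn; rewrite ei ej eij eqxx.
Qed.

Let w_norm x n : '[x, w n] * '[w n, w n] = '[x, w n].
Proof.
have [[i ei ->]|->] := w_cases n; last by rewrite dot0r mul0r.
by rewrite von eqxx mulr1.
Qed.

Let S (n : nat) x : H := \sum_(k < n) '[x, w k] *: w k.

Let S_coef n x k : (k < n)%N -> '[S n x, w k] = '[x, w k].
Proof.
move=> kn; rewrite /S dot_suml (bigD1 (Ordinal kn)) //= big1 ?addr0.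
  by rewrite dotZl w_norm.
by move=> j jk; rewrite dotZl w_orth ?mulr0.
Qed.

Let S_sa n : selfadj (S n).
Proof.
move=> x y; rewrite /S dot_suml dot_sumr; apply: eq_bigr => k _.
by rewrite dotZl dotZr mulrC -(dotC (w k) y).
Qed.

Let S_comp m n x : (m <= n)%N -> S m (S n x) = S m x.
Proof.
move=> mn; apply: eq_bigr => k _; rewrite S_coef //.
exact: leq_trans (ltn_ord k) mn.
Qed.

Let S_proj n : proj (S n).
Proof. by split=> // x; exact: S_comp. Qed.

Let S_sub m n x : (m <= n)%N ->
  nrm (S m x - S n x) ^+ 2 = nrm (S n x) ^+ 2 - nrm (S m x) ^+ 2.
Proof.
move=> mn; apply: complexI; rewrite rmorphB /= -!dotxx.
have E k : '[S k x, S k x] = '[S k x, x] by rewrite -S_sa S_comp.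
rewrite dotBl !dotBr !E.
have -> : '[S m x, S n x] = '[S m x, x] by rewrite S_sa S_comp // -S_sa.
have -> : '[S n x, S m x] = '[S m x, x] by rewrite -S_sa S_comp.
by ring.
Qed.

Let S_cvg x : exists l, converges_to (S ^~ x) l.
Proof.
pose s n := nrm (S n x) ^+ 2.
have sb n : s n <= nrm x ^+ 2.
  rewrite /s; have := proj_contraction (S_proj n) x; rewrite mul1r => h.
  by rewrite ler_pXn2r // nnegrE nrm_ge0.
have hs : has_sup (range s).
  split; first by exists (s 0%N), 0%N.
  by exists (nrm x ^+ 2) => _ [n _ <-].
apply: nrm_complete => e e0.
have e2 : 0 < e ^+ 2 by rewrite exprn_gt0.
have [_ [N _ <-] hN] := sup_adherent e2 hs.
exists N => m n Nm mn.
have h1 : s n <= sup (range s) by apply: (sup_upper_bound hs); exists n.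
have h2 : s N <= s m.
  by rewrite -subr_ge0 /s -S_sub // exprn_ge0 ?nrm_ge0.
rewrite -(@ltr_pXn2r _ 2) ?nnegrE ?nrm_ge0 ?(ltW e0) // S_sub // -/(s n) -/(s m).
lra.
Qed.

(** The partial Fourier sums are projections and increase with [n]: the square of
    the distance between two of them is the increment of the square norms, which
    are bounded.  Hence they converge pointwise.  The two last clauses compute
    the limit on the vectors used later, which meet at most one member of the
    family. *)
Lemma proj_of_family : exists P : H -> H, [/\ proj P,
  forall x i, (forall j, j != i -> '[x, v j] = 0) -> P x = '[x, v i] *: v i &
  forall x, (forall j, '[x, v j] = 0) -> P x = 0].
Proof.
have /(_ _)/cid-/all_sig[P Pl] := S_cvg.
have Psa : selfadj P.
  by move=> x y; apply: (limit_dot (Pl x) (Pl y)) => n; exact: S_sa.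
have Pcoef x k : '[P x, w k] = '[x, w k].
  have h : converges_to (fun n => S (n + k.+1) x) (P x).
    by move=> e /(Pl x)[N hN]; exists N => n Nn; apply: hN; exact: leq_trans Nn (leq_addr _ _).
  have h' : converges_to (fun=> w k) (w k) by exact: (@limit_near_cst _ _ 0%N).
  by apply: (limit_dot h h') => n; rewrite S_coef // addnS ltnS leq_addl.
have PS x y : (forall k, '[x, w k] = '[y, w k]) -> P x = P y.
  move=> xy; apply: (limit_unique (Pl x)); apply: limit_ext (Pl y) => n.
  by apply: eq_bigr => k _; rewrite xy.
have w0 x : (forall j, '[x, v j] = 0) -> forall k, '[x, w k] = 0.
  by move=> h k; have [[i _ ->]|->] := w_cases k; rewrite ?h ?dot0r.
have P0 x : (forall j, '[x, v j] = 0) -> P x = 0.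
  move=> /w0 h; apply: (limit_unique (Pl x)).
  apply: (@limit_near_cst _ _ 0%N) => n _.
  by apply: big1 => k _; rewrite h scale0r.
exists P; split=> //; first by split=> // x; apply: PS.
move=> x i h; rewrite -[x in LHS](subrK ('[x, v i] *: v i)) (selfadjD _ _ Psa) (selfadjZ _ _ Psa).
rewrite P0 ?add0r => [|j]; last first.
  rewrite dotBl dotZl von; case: (eqVneq i j) => [<-|ij].
    by rewrite mulr1 subrr.
  by rewrite mulr0 subr0 h // eq_sym.
have -> // : P (v i) = v i.
apply: (limit_unique (Pl (v i))); apply: (@limit_near_cst _ _ (pickle i).+1) => n ni.
rewrite /S (bigD1 (Ordinal ni)) //= w_pickle von eqxx scale1r big1 ?addr0 //.
by move=> k ki; rewrite -(w_pickle i) w_orth ?scale0r // eq_sym.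
Qed.

End PartialSums.

(** * Four projections from paths *)

Definition orthonormal_family (I : eqType) (v : I -> H) :=
  forall i j, '[v i, v j] = (i == j)%:R.

(** In each plane spanned by [u i] and [w i], project onto the line at angle
    arccos (sqrt (t i)).  The two diagonal coefficients are the squares of the
    cosine and sine; there are no other coefficients within either family. *)
Lemma proj_rotated_pairs (I : countType) (u w : I -> H) (t : I -> R) :
  orthonormal_family u -> orthonormal_family w -> (forall i j, '[u i, w j] = 0) ->
  (forall i, 0 <= t i <= 1) ->
  exists P, [/\ proj P,
    forall i j, '[P (u i), u j] = (i == j)%:R * (t i)%:C &
    forall i j, '[P (w i), w j] = (i == j)%:R * (1 - t i)%:C].
Proof.
move=> uon won uw t01.
pose a i := (Num.sqrt (t i))%:C; pose b i := (Num.sqrt (1 - t i))%:C.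
have aa i : a i * a i = (t i)%:C.
  by rewrite -rmorphM -expr2 sqr_sqrtr //; case/andP: (t01 i).
have bb i : b i * b i = (1 - t i)%:C.
  by rewrite -rmorphM -expr2 sqr_sqrtr // subr_ge0; case/andP: (t01 i).
pose v i := a i *: u i + b i *: w i.
have wu i j : '[w i, u j] = 0 by exact: dot_sym0.
have uv i j : '[u i, v j] = (i == j)%:R * a i.
  rewrite dotDr !dotZrr uon uw mulr0 addr0 mulrC.
  by case: eqVneq => [->//|]; rewrite !mul0r.
have wv i j : '[w i, v j] = (i == j)%:R * b i.
  rewrite dotDr !dotZrr won wu mulr0 add0r mulrC.
  by case: eqVneq => [->//|]; rewrite !mul0r.
have von i j : '[v i, v j] = (i == j)%:R.
  rewrite {1}/v dotDl !dotZl uv wv; case: eqVneq => _; last by rewrite !mul0r !mulr0 addr0.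
  by rewrite !mul1r aa bb -rmorphD /= addrC subrK.
have [P [pP Pv _]] := proj_of_family von.
exists P; split=> // i j.
  rewrite (Pv _ i) => [|k ki]; last by rewrite uv eq_sym (negPf ki) mul0r.
  by rewrite uv eqxx mul1r dotZl dotDl !dotZl uon wu mulr0 addr0 mulrA aa mulrC.
rewrite (Pv _ i) => [|k ki]; last by rewrite wv eq_sym (negPf ki) mul0r.
by rewrite wv eqxx mul1r dotZl dotDl !dotZl won uw mulr0 add0r mulrA bb mulrC.
Qed.

Lemma half_shift_itv (z k K : R) : `|z| <= K -> K + K <= `|k| -> 0 < `|k| ->
  0 <= 2^-1 + z / k <= 1.
Proof.
move=> zK Kk k0.
have h : `|z / k| <= 2^-1.
  rewrite normrM normfV ler_pdivrMr //; lra.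
by have := ler_norm (z / k); have := ler_norm (- (z / k)); rewrite normrN; lra.
Qed.

(** The first projection pairs [x i] with [y i], the second one pairs [y i] with
    [x (succ i)].  Their combination matches the diagonal blocks of [A], and the
    remainder is off-diagonal. *)
Lemma four_proj_of_paths (I : countType) (x y : I -> H) (succ pred : I -> I)
    (A : H -> H) (M c K : R) (dx dy zeta xi : I -> R) :
  selfadj A -> bounded_by M A ->
  orthonormal_family x -> orthonormal_family y -> (forall i j, '[x i, y j] = 0) ->
  (forall z, (forall i, '[z, x i] = 0) -> (forall i, '[z, y i] = 0) -> z = 0) ->
  (forall i j, '[A (x i), x j] = (i == j)%:R * (c + dx i)%:C) ->
  (forall i j, '[A (y i), y j] = (i == j)%:R * (c + dy i)%:C) ->
  cancel succ pred -> cancel pred succ ->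
  (forall i, dx i = zeta i - xi (pred i)) -> (forall i, dy i = xi i - zeta i) ->
  (forall i, `|zeta i| <= K) -> (forall i, `|xi i| <= K) ->
  exists (a1 a2 a3 a4 : R) (P1 P2 P3 P4 : H -> H),
    [/\ proj P1, proj P2, proj P3 & proj P4] /\
    forall z, A z = a1%:C *: P1 z + a2%:C *: P2 z + a3%:C *: P3 z + a4%:C *: P4 z.
Proof.
move=> sA bA xon yon xy tot Ax Ay succK predK dxE dyE zK xK.
have yx i j : '[y i, x j] = 0 by exact: dot_sym0.
(* alpha + beta = 2 c, while both have absolute value at least 2 K *)
pose L := `|c| + `|K| + `|K| + 1; pose al := c + L; pose be := c - L.
have KK := ler_norm K; have K0 := normr_ge0 K; have c0 := normr_ge0 c.
have := ler_norm c; have := ler_norm (- c); rewrite normrN => c1 c2.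
have al0 : al != 0 by rewrite gt_eqF // /al /L; lra.
have be0 : be != 0 by rewrite lt_eqF // /be /L; lra.
have alK : K + K <= `|al| by rewrite ger0_norm /al /L; lra.
have beK : K + K <= `|be| by rewrite ler0_norm /be /L; lra.
have [i|P1 [pP1 P1x P1y]] := @proj_rotated_pairs I x y (fun i => 2^-1 + zeta i / al) xon yon xy.
  by apply: half_shift_itv (zK i) alK _; rewrite normr_gt0.
have xon' : orthonormal_family (x \o succ).
  by move=> i j /=; rewrite xon (can_eq succK).
have [i j|i|P2 [pP2 P2y P2x]] :=
    @proj_rotated_pairs I y (x \o succ) (fun i => 2^-1 + xi i / be) yon xon' _.
- exact: yx.
- by apply: half_shift_itv (xK i) beK _; rewrite normr_gt0.
have [Q [pQ Qx Qy]] := proj_of_family xon.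
have {}Qx i : Q (x i) = x i.
  by rewrite (Qx _ i) => [|j ji]; rewrite xon ?eqxx ?scale1r // eq_sym (negPf ji).
have {}Qy i : Q (y i) = 0 by exact: Qy.
have [sP1 _] := pP1; have [sP2 _] := pP2; have [sQ _] := pQ.
pose N z := A z - al%:C *: P1 z - be%:C *: P2 z.
have sN : selfadj N.
  by move=> z z'; rewrite /N !dotBl !dotBr !dotZl !dotZrr sA sP1 sP2.
have Nx i j : '[N (x i), x j] = 0.
  rewrite !dotBl !dotZl Ax P1x.
  have := P2x (pred i) (pred j); rewrite /= !predK => ->.
  rewrite (can_eq predK) dxE; case: eqVneq => _; last by rewrite !mul0r !mulr0 !subr0.
  rewrite !mul1r -!rmorphM -!rmorphB /= -(rmorph0 (real_complex R)); congr (_%:C).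
  by rewrite /al /be; field; rewrite -/al -/be al0 be0.
have Ny i j : '[N (y i), y j] = 0.
  rewrite !dotBl !dotZl Ay P1y P2y dyE.
  case: eqVneq => _; last by rewrite !mul0r !mulr0 !subr0.
  rewrite !mul1r -!rmorphM -!rmorphB /= -(rmorph0 (real_complex R)); congr (_%:C).
  by rewrite /al /be; field; rewrite -/al -/be al0 be0.
(* N maps each half into the other one *)
have QNx i : Q (N (x i)) = 0.
  apply: tot => j; first by rewrite sQ Qx Nx.
  by rewrite sQ Qy dot0r.
have QNy i : Q (N (y i)) = N (y i).
  apply/eqP; rewrite -subr_eq0; apply/eqP/tot => j.
    by rewrite dotBl sQ Qx subrr.
  by rewrite dotBl sQ Qy dot0r Ny subrr.
have NQ z : N z = N (Q z) + Q (N z).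
  apply/eqP; rewrite -subr_eq0; apply/eqP/tot => j.
    by rewrite dotBl dotDl sN sQ Qx !sN !sQ QNx dot0r add0r subrr.
  by rewrite dotBl dotDl sQ Qy dot0r addr0 !sN sQ QNy subrr.
pose M' := `|M| + `|al| + `|be|.
have bN : bounded_by M' N.
  move=> z; rewrite /N; have h1 := nrmD (A z - al%:C *: P1 z) (- (be%:C *: P2 z)).
  have h2 := nrmD (A z) (- (al%:C *: P1 z)); rewrite !nrmN !nrmZr in h1 h2.
  have := ler_wpM2l (normr_ge0 al) (proj_contraction pP1 z).
  have := ler_wpM2l (normr_ge0 be) (proj_contraction pP2 z).
  have := bA z; have := ler_wpM2r (nrm_ge0 z) (ler_norm M).
  rewrite /M' !mulrDl !mul1r; lra.
(* the remainder has norm at most 1/2 after division by g *)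
pose g := 2 * M' + 1.
have M'0 : 0 <= M' by rewrite !addr_ge0.
have g0 : 0 < g by rewrite /g; lra.
have sN' : selfadj (fun z => (g^-1)%:C *: N z).
  by move=> z z'; rewrite dotZl dotZrr sN.
have bN' : bounded_by 2^-1 (fun z => (g^-1)%:C *: N z).
  move=> z; rewrite nrmZr gtr0_norm ?invr_gt0 // ler_pdivrMl //.
  apply: le_trans (bN z) _; rewrite mulrA; apply: ler_wpM2r; rewrite ?nrm_ge0 //.
  by rewrite /g; lra.
have [|P3 [P4 [pP3 pP4 NE]]] := offdiag_proj_sub sN' bN' pQ.
  by move=> z; rewrite (selfadjZ _ _ sQ) -scalerDr -NQ.
exists al, be, g, (- g), P1, P2, P3, P4; split=> // z.
have -> : A z = al%:C *: P1 z + be%:C *: P2 z + N z.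
  by apply: dot_ext => z'; rewrite /N !(dotDl, dotNl); ring.
have -> : N z = g%:C *: (P3 z - P4 z).
  by rewrite -NE scalerA -rmorphM mulfV ?gt_eqF // scale1r.
by rewrite scalerBr rmorphN scaleNr addrA.
Qed.

(** * Finite orthonormal systems *)

Section Tower.
Local Notation onl := (orthonormal dot).
Hypothesis Hinf : ~ finite_dimensional H.

Definition perp (L : seq H) x := forall l, l \in L -> '[x, l] = 0.

(** For a finite orthonormal [L] this is the span of [L].  As a double orthogonal
    complement it needs no coefficients, and orthogonality to [L] passes to it
    directly. *)
Definition bispan (L : seq H) t := forall x, perp L x -> '[x, t] = 0.

Lemma bispan_sub (L L' : seq H) t : {subset L <= L'} -> bispan L t -> bispan L' t.
Proof. by move=> LL Lt x xL'; apply: Lt => l /LL; exact: xL'. Qed.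

Lemma onl_dot L u v : onl L -> u \in L -> v \in L -> '[u, v] = (u == v)%:R.
Proof. by move=> /orthonormalP[_ h] uL vL; rewrite h. Qed.

Lemma onl_cat L L' : onl L -> onl L' -> (forall u, u \in L' -> perp L u) -> onl (L ++ L').
Proof.
move=> oL oL' LL'; rewrite orthonormal_cat oL oL' /=.
apply/allP => u uL; apply/allP => v vL' /=; apply/eqP/dot_sym0.
exact: (LL' v vL' u uL).
Qed.

Lemma onl_cat_perp L L' u : onl (L ++ L') -> u \in L' -> perp L u.
Proof.
rewrite orthonormal_cat => /and3P[_ _ /allP h] uL' l lL.
by apply: dot_sym0; have /allP/(_ _ uL')/eqP := h l lL.
Qed.

Lemma onl1 u : '[u, u] = 1 -> onl [:: u].
Proof.
move=> u1; apply/orthonormalP; split=> // v w; rewrite !inE => /eqP-> /eqP->.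
by rewrite eqxx.
Qed.

Lemma normalize x : x != 0 -> exists2 v, '[v, v] = 1 & x = (nrm x)%:C *: v.
Proof.
move=> x0; have nx : nrm x != 0 by apply: contra_neq x0; exact: nrm_eq0.
exists ((nrm x)^-1%:C *: x); last by rewrite scalerA -rmorphM mulfV // scale1r.
rewrite dotZl dotZrr dotxx // -!rmorphM -(rmorph1 (real_complex R)).
by congr (_%:C); field.
Qed.

(** One step of the Gram-Schmidt process. *)
Lemma residual_perp L x : onl L -> perp L (x - \sum_(l <- L) '[x, l] *: l).
Proof.
move=> oL l lL; have /orthonormalP[uL _] := oL.
have lE k : k \in L -> '[k, l] = (k == l)%:R by move=> kL; exact: (onl_dot oL kL lL).
rewrite dotBl dot_suml (bigD1_seq l) //= dotZl (lE l lL) eqxx mulr1 big_seq_cond.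
rewrite big1 ?addr0 ?subrr // => k /andP[kL kl].
by rewrite dotZl (lE k kL) (negPf kl) mulr0.
Qed.

(** Otherwise every vector would equal its Fourier sum over [L]. *)
Lemma fresh_unit L : onl L -> exists2 v, '[v, v] = 1 & perp L v.
Proof.
move=> oL; pose r x := x - \sum_(l <- L) '[x, l] *: l.
have [x rx] : exists x, r x != 0.
  apply: contra_notP Hinf => /forallNP h.
  exists (size L), (fun i => L`_i) => x; exists (fun i => '[x, L`_i]).
  rewrite -(big_mkord xpredT (fun i => '[x, L`_i] *: L`_i)) -(big_nth 0 xpredT (fun l => '[x, l] *: l)).
  by have /negP := h x; rewrite negbK subr_eq0 => /eqP.
have [v v1 rE] := normalize rx; exists v => // l lL.
have := residual_perp x oL lL; rewrite -/(r x) rE dotZl => /eqP.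
rewrite mulf_eq0 => /orP[/eqP n0|/eqP//].
by move: rx; rewrite rE n0 scale0r eqxx.
Qed.

(** Exactly one vector is added: the normalized residual of [t], or an arbitrary new
    direction if [t] is already in the span. *)
Lemma extend_one L t : onl L -> exists2 v, onl (rcons L v) & bispan (rcons L v) t.
Proof.
move=> oL; pose r := t - \sum_(l <- L) '[t, l] *: l.
have tE : t = r + \sum_(l <- L) '[t, l] *: l by rewrite subrK.
have rL : perp L r by exact: residual_perp.
have [v [v1 vL [a rv]]] : exists v, [/\ '[v, v] = 1, perp L v & exists a, r = a *: v].
  have [r0|r0] := eqVneq r 0.
    by have [v v1 vL] := fresh_unit oL; exists v; split=> //; exists 0; rewrite scale0r.
  have [v v1 rE] := normalize r0; exists v; split=> //; last by exists (nrm r)%:C.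
  move=> l lL; have /eqP := rL l lL; rewrite rE dotZl mulf_eq0 => /orP[/eqP n0|/eqP//].
  by move: r0; rewrite rE n0 scale0r eqxx.
exists v; rewrite -cats1.
  by apply: onl_cat => //; [exact: onl1|move=> u; rewrite inE => /eqP->].
move=> x xL; rewrite tE dotDr dot_sumr rv dotZr xL ?mem_cat ?mem_seq1 ?eqxx ?orbT //.
rewrite mulr0 add0r big_seq big1 // => l lL.
by rewrite dotZr xL ?mulr0 // mem_cat lL.
Qed.

Lemma extend_seq L (ts : seq H) : onl L ->
  exists W, [/\ size W = size ts, onl (L ++ W) & forall t, t \in ts -> bispan (L ++ W) t].
Proof.
elim: ts L => [|t ts IH] L oL; first by exists [::]; rewrite cats0.
have [v ov tv] := extend_one t oL; have [W [sW oW tW]] := IH _ ov.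
exists (v :: W); rewrite -cat_rcons; split=> //=; first by rewrite sW.
move=> u; rewrite inE => /orP[/eqP->|]; last exact: tW.
by apply: bispan_sub tv => l lv; rewrite mem_cat lv.
Qed.

(** Extend the empty system until its span contains [S]. *)
Lemma unit_perp (S : seq H) : exists2 f, '[f, f] = 1 & perp S f.
Proof.
have [|L [_ oL SL]] := @extend_seq [::] S; first exact/orthonormalP.
by have [f f1 fL] := fresh_unit oL; exists f => // s sS; exact: (SL s sS f fL).
Qed.

Variables (A : H -> H) (M : R).
Hypotheses (sA : selfadj A) (bA : bounded_by M A).

(** The quadratic form is real because [A] is self-adjoint; on unit vectors it gives
    the diagonal coefficients of [A]. *)
Definition qform f : R := complex.Re '[A f, f].

Lemma qformE f : '[A f, f] = (qform f)%:C.
Proof.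
rewrite RRe_real //; apply/CrealP.
by rewrite -[LHS](dotC f (A f)) sA.
Qed.

Lemma qform_bound f : '[f, f] = 1 -> `|qform f| <= M.
Proof.
move=> f1.
have nf : nrm f = 1.
  have := f1; rewrite dotxx // => /complexI /eqP.
  by rewrite sqrf_eq1 => /orP[/eqP//|/eqP h]; have := nrm_ge0 f; rewrite h; lra.
have := cauchy_schwarz (A f) f; rewrite qformE cabsR nf mulr1 => h.
by apply: le_trans h _; have := bA f; rewrite nf mulr1.
Qed.

(** Let m(S) be the infimum of the quadratic form on the unit vectors orthogonal to
    [S].  It increases with [S] and is bounded, and [c] is its supremum over the
    finite [S], the bottom of the essential spectrum.  Once m(S0) is close to [c],
    m(S0 ++ S) is too, and the infimum is nearly attained. *)
Lemma essential_value : exists c : R, forall (S : seq H) (e : R), 0 < e ->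
  exists f, [/\ '[f, f] = 1, perp S f & `|qform f - c| <= e].
Proof.
pose V S := [set qform f | f in [set f | '[f, f] = 1 /\ perp S f]]%classic.
have Vinf S : has_inf (V S).
  split; first by have [f f1 fS] := unit_perp S; exists (qform f), f.
  by exists (- M) => _ [f [f1 _] <-]; have := qform_bound f1; rewrite ler_norml => /andP[].
pose m S := inf (V S).
have mM S : m S <= M.
  have [[_ [f [f1 fS] _]] _] := Vinf S.
  apply: (@le_trans _ _ (qform f)); last by have := qform_bound f1; rewrite ler_norml => /andP[].
  by apply: (ge_inf (Vinf S).2); exists f.
have msup : has_sup (range m).
  split; first by exists (m [::]), [::].
  by exists M => _ [S _ <-]; exact: mM.
exists (sup (range m)) => S e e0.
have [_ [S0 _ <-] hS0] := sup_adherent e0 msup.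
have mc : m (S0 ++ S) <= sup (range m).
  by apply: (sup_upper_bound msup); exists (S0 ++ S).
have m0 : m S0 <= m (S0 ++ S).
  apply: lb_le_inf; first exact: (Vinf _).1.
  move=> _ [f [f1 fS] <-]; apply: (ge_inf (Vinf S0).2); exists f => //; split=> // l lS.
  by apply: fS; rewrite mem_cat lS.
have [_ [f [f1 fS] <-] hf] := inf_adherent e0 (Vinf (S0 ++ S)).
exists f; split=> //; first by move=> l lS; apply: fS; rewrite mem_cat lS orbT.
have : m (S0 ++ S) <= qform f by apply: (ge_inf (Vinf _).2); exists f.
rewrite ler_distl -/(m _) in hf *; lra.
Qed.

Lemma onl_nth L i j : onl L -> (i < size L)%N -> (j < size L)%N ->
  '[L`_i, L`_j] = (i == j)%:R.
Proof.
move=> oL iL jL; rewrite (onl_dot oL) ?mem_nth // nth_uniq //.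
by have /orthonormalP[] := oL.
Qed.

Lemma onl_of_nth n (w : 'I_n -> H) : (forall i j, '[w i, w j] = (i == j)%:R) ->
  onl [seq w i | i <- enum 'I_n].
Proof.
move=> wo; have wi : injective w.
  move=> i j ij; apply/eqP; have := wo i j; rewrite ij wo eqxx.
  by case: (i == j) => // /eqP; rewrite oner_eq0.
apply/orthonormalP; split; first by rewrite map_inj_uniq ?enum_uniq.
by move=> _ _ /mapP[i _ ->] /mapP[j _ ->]; rewrite wo (inj_eq wi).
Qed.

(** Spectral theorem for the Hermitian matrix of the compression of [A] to the span
    of [W]: the unitary matrix that diagonalizes it gives the new basis. *)
Lemma diagonalize W : onl W -> exists W', [/\ size W' = size W, onl W',
  forall x, perp W x <-> perp W' x &
  forall i j, (i < size W)%N -> (j < size W)%N -> i != j -> '[A W'`_i, W'`_j] = 0].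
Proof.
move=> oW; set n := size W; pose w (i : 'I_n) := W`_i.
have wo i j : '[w i, w j] = (i == j)%:R by rewrite onl_nth.
pose B : 'M[R[i]]_n := \matrix_(i, j) '[A (w i), w j].
have BJ i j : (B j i)^* = B i j by rewrite !mxE -(dotC (w i)) sA.
have /hermitian_normalmx/orthomx_spectralP BE : B \is hermsymmx.
  apply/is_hermitianmxP; rewrite expr0 scale1r; apply/matrixP => i j.
  by rewrite [RHS]mxE [in RHS]mxE BJ.
set P := spectralmx B in BE; set D := spectral_diag B in BE.
have uP : P \is unitarymx by exact: spectral_unitarymx.
pose w' i := \sum_k P i k *: w k.
have PP : P *m map_mx (@Num.conj R[i]) P^T = 1%:M by exact/unitarymxP.
(* for f = id this computes the Gram matrix, for f = A the compression *)
have dw' (f : H -> H) (C : 'M[R[i]]_n) : selfadj f -> (forall i j, '[f (w i), w j] = C i j) ->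
    forall i j, '[f (w' i), w' j] = (P *m C *m map_mx (@Num.conj R[i]) P^T) i j.
  move=> sf fC i j; rewrite dot_sumr mxE; apply: eq_bigr => k _.
  rewrite dotZr !mxE mulrC sf dot_suml; congr (_ * _); apply: eq_bigr => l _.
  by rewrite dotZl -sf fC.
have w'o i j : '[w' i, w' j] = (i == j)%:R.
  rewrite (dw' id 1%:M) // => [|k l]; last by rewrite wo mxE.
  by rewrite mulmx1 PP mxE.
have w'A i j : i != j -> '[A (w' i), w' j] = 0.
  move=> ij; rewrite (dw' A B) // => [|k l]; last by rewrite mxE.
  rewrite BE mulmxA mulmxA mulmxV ?spectral_unit // mul1mx -mulmxA PP mulmx1 mxE.
  by rewrite (negPf ij).
have wE k : w k = \sum_i (map_mx (@Num.conj R[i]) P^T) k i *: w' i.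
  under eq_bigr do rewrite scaler_sumr.
  rewrite exchange_big /= (bigD1 k) //= [X in _ + X]big1 ?addr0 => [|l lk].
    rewrite -[LHS]scale1r; under eq_bigr do rewrite scalerA.
    rewrite -scaler_suml; congr (_ *: _).
    have := mulVmx (unitarymx_unit uP); rewrite invmx_unitary // => /matrixP/(_ k k).
    by rewrite !mxE eqxx => ->.
  under eq_bigr do rewrite scalerA.
  rewrite -scaler_suml.
  have := mulVmx (unitarymx_unit uP); rewrite invmx_unitary // => /matrixP/(_ k l).
  by rewrite !mxE eq_sym (negPf lk) => ->; rewrite scale0r.
have w'nth (i : 'I_n) : [seq w' i | i <- enum 'I_n]`_i = w' i.
  by rewrite (nth_map i) ?size_enum_ord // nth_ord_enum.
exists [seq w' i | i <- enum 'I_n]; split.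
- by rewrite size_map size_enum_ord.
- exact: onl_of_nth.
- move=> x; split=> [xW _ /mapP[i _ ->]|xW' _ /(nthP 0)[k kn <-]].
    by rewrite dot_sumr big1 // => k _; rewrite dotZr xW ?mulr0 ?mem_nth.
  rewrite -/(w (Ordinal kn)) wE dot_sumr big1 // => i _.
  by rewrite dotZr xW' ?mulr0 // map_f ?mem_enum.
- move=> i j iW jW ij; rewrite (w'nth (Ordinal iW)) (w'nth (Ordinal jW)).
  exact: w'A.
Qed.

(** The new level absorbs the targets [ts] and is diagonalized.  Its head [f] is then
    added, chosen orthogonal to everything so far and to the image under [A] of
    the rest of the level, so that the level stays diagonal. *)
Lemma next_level (c : R) (F ts : seq H) (e : R) :
  (forall (S : seq H) (e : R), 0 < e ->
     exists f, [/\ '[f, f] = 1, perp S f & `|qform f - c| <= e]) ->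
  onl F -> (0 < size ts)%N -> 0 < e ->
  exists W, [/\ (1 < size W)%N, onl (F ++ W),
    forall t, t \in ts -> bispan (F ++ W) t,
    forall i j, (i < size W)%N -> (j < size W)%N -> i != j -> '[A W`_i, W`_j] = 0 &
    `|qform W`_0 - c| <= e].
Proof.
move=> cP oF ts0 e0; have [W1 [sW1 oFW1 tW1]] := extend_seq ts oF.
have oW1 : onl W1 by move: oFW1; rewrite orthonormal_cat => /and3P[].
have [W [sW oW pW dW]] := diagonalize oW1.
have oFW : onl (F ++ W).
  apply: onl_cat => // u uW l lF.
  apply: dot_sym0; move: u uW; apply/pW => u uW1; apply: dot_sym0.
  exact: (onl_cat_perp oFW1 uW1).
have [f [f1 fS fc]] := cP (F ++ W ++ map A W) e e0.
have fF : perp F f by move=> l lF; apply: fS; rewrite mem_cat lF.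
have fW : perp W f by move=> l lW; apply: fS; rewrite !mem_cat lW orbT.
have fAW : perp (map A W) f by move=> l lW; apply: fS; rewrite !mem_cat lW !orbT.
exists (f :: W); split=> //.
- by rewrite /= sW sW1 ltnS.
- rewrite -cat_rcons -cats1 -catA cat1s; apply: onl_cat => //.
    rewrite -cat1s; apply: onl_cat => //; first exact: onl1.
    by move=> u uW l; rewrite inE => /eqP->; apply: dot_sym0; exact: fW.
  move=> u; rewrite inE => /orP[/eqP-> //|uW]; exact: (onl_cat_perp oFW uW).
- move=> t tts x xS; apply: (tW1 t tts) => l; rewrite mem_cat => /orP[lF|lW1].
    by apply: xS; rewrite mem_cat lF.
  move: l lW1; apply/pW => l lW; apply: xS.
  by rewrite mem_cat inE lW !orbT.
- move=> [|i] [|j] //=; rewrite ?ltnS => iW jW ij.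
  + by rewrite sA; apply: fAW; rewrite map_f ?mem_nth.
  + by apply: dot_sym0; apply: fAW; rewrite map_f ?mem_nth.
  + by apply: dW; rewrite -?sW.
Qed.

(** * A block tridiagonal tower *)

(** The pair (n, i) designates the i-th vector of level n; the vector with i = 0 is the
    good one. *)
Definition tower_vec (lev : nat -> seq H) (v : nat * nat) : H := nth 0 (lev v.1) v.2.
Definition in_tower (lev : nat -> seq H) (v : nat * nat) := (v.2 < size (lev v.1))%N.

(** Level n + 1 has as targets the images under [A] of level n, so that [A] maps the
    levels up to n into the span of those up to n + 1, to which every later level
    is orthogonal.  Consequently two distinct vectors on levels of the same parity
    have a zero matrix coefficient: distinct such levels are at least two apart,
    and each single level is diagonal.  The further target [b n] makes the tower as
    large as the sequence [b]. *)
Lemma tower (b : nat -> H) : exists (c : R) (lev : nat -> seq H), [/\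
  forall n, (1 < size (lev n))%N,
  forall u v, in_tower lev u -> in_tower lev v -> '[tower_vec lev u, tower_vec lev v] = (u == v)%:R,
  forall u v, in_tower lev u -> in_tower lev v -> u != v -> odd u.1 = odd v.1 ->
    '[A (tower_vec lev u), tower_vec lev v] = 0,
  forall n, `|qform (tower_vec lev (n, 0)) - c| <= 2^-1 ^+ n &
  forall z n, (forall v, in_tower lev v -> '[z, tower_vec lev v] = 0) -> '[z, b n] = 0].
Proof.
have [c cP] := essential_value.
have /(_ _)/cid-/all_sig[nx nxP] (k : nat * (seq H * seq H)) :
  exists W, onl k.2.1 -> [/\ (1 < size W)%N, onl (k.2.1 ++ W),
    forall t, t \in b k.1 :: map A k.2.2 -> bispan (k.2.1 ++ W) t,
    forall i j, (i < size W)%N -> (j < size W)%N -> i != j -> '[A W`_i, W`_j] = 0 &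
    `|qform W`_0 - c| <= 2^-1 ^+ k.1].
  have [oF|] := boolP (onl k.2.1); last by exists [::].
  have e0 : 0 < (2^-1 : R) ^+ k.1 by rewrite exprn_gt0 ?invr_gt0.
  have [W] := @next_level c k.2.1 (b k.1 :: map A k.2.2) _ cP oF isT e0.
  by exists W.
pose st := fix st n := if n is n'.+1 then
  ((st n').1 ++ nx (n', st n'), nx (n', st n')) else ([::], [::]) : seq H * seq H.
pose F n := (st n).1; pose lev n := (st n.+1).2.
have FS n : F n.+1 = F n ++ lev n by [].
have oF n : onl (F n).
  elim: n => [|n IH]; first exact/orthonormalP.
  by have [] := nxP (n, st n) IH.
have spec n := nxP (n, st n) (oF n); rewrite /= -/(F _) -/(lev _) in spec.
have levE n : nx (n, st n) = lev n by [].
have Fsub m n : (m <= n)%N -> {subset F m <= F n}.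
  elim: n => [|n IH]; first by rewrite leqn0 => /eqP->.
  rewrite leq_eqVlt => /orP[/eqP-> //|]; rewrite ltnS => /IH h l /h lF.
  by rewrite FS mem_cat lF.
have levF m n : (m < n)%N -> {subset lev m <= F n}.
  by move=> mn l lm; apply: (Fsub _ _ mn); rewrite FS mem_cat lm orbT.
have olev n : onl (lev n).
  by have := oF n.+1; rewrite FS orthonormal_cat => /and3P[].
have levperp n u : u \in lev n -> perp (F n) u.
  by apply: onl_cat_perp; rewrite -FS.
have vlev v : in_tower lev v -> tower_vec lev v \in lev v.1 by move=> vv; exact: mem_nth.
exists c, lev; split.
- by move=> n; have [] := spec n.
- have H1 u v : in_tower lev u -> in_tower lev v -> (u.1 < v.1)%N -> '[tower_vec lev u, tower_vec lev v] = 0.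
    move=> uv vv uv1; apply: dot_sym0; apply: (levperp _ _ (vlev v vv)).
    exact: levF uv1 _ (vlev u uv).
  move=> u v uv vv; have [e|uv1|uv1] := ltngtP u.1 v.1.
  + by rewrite H1 //; case: eqP e => // ->; rewrite ltnn.
  + by rewrite dot_sym0 ?H1 //; case: eqP uv1 => // ->; rewrite ltnn.
  + case: u v uv vv uv1 => [n i] [m j] /= uv vv e; subst m.
    by rewrite /tower_vec /= onl_nth // xpair_eqE eqxx.
- have H2 u v : in_tower lev u -> in_tower lev v -> (u.1 < v.1)%N -> odd u.1 = odd v.1 ->
      '[tower_vec lev v, A (tower_vec lev u)] = 0.
    move=> uv vv uv1 par.
    have uv2 : (u.1.+2 <= v.1)%N.
      rewrite ltn_neqAle uv1 andbT; apply/eqP => e; move: par; rewrite -e /=.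
      by case: (odd _).
    have [_ _ tb _ _] := spec u.1.+1.
    have : A (tower_vec lev u) \in b u.1.+1 :: map A (st u.1.+1).2.
      by rewrite inE map_f ?orbT // vlev.
    move=> /tb; apply => l lF; apply: (levperp _ _ (vlev v vv)).
    by apply: (Fsub _ _ uv2).
  move=> u v uv vv uNv par; have [e|e|e] := ltngtP u.1 v.1.
  + by apply: dot_sym0; exact: H2.
  + by rewrite sA H2.
  + case: u v uv vv e uNv par => [n i] [m j] /= uv vv e; subst m.
    rewrite xpair_eqE eqxx /= => ij _; have [_ _ _ d _] := spec n.
    exact: d.
- by move=> n; have [_ _ _ _] := spec n.
- move=> z n zv; have [_ _ tb _ _] := spec n.
  apply: (tb (b n)); first by rewrite inE eqxx.
  rewrite levE -FS; elim: (n.+1) => [|k IH] l //.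
  rewrite FS mem_cat => /orP[/IH//|/(nthP 0)[i il <-]].
  exact: (zv (k, i) il).
Qed.

(** If z is nonzero and orthogonal to a point y with |z - y| < |z|, then
    |z|^2 = <z, z - y> < |z|^2. *)
Lemma dense_seq : separable H -> exists b : nat -> H,
  forall z, (forall n, '[z, b n] = 0) -> z = 0.
Proof.
move=> [D [cD dD]]; have /countable_injP[f fi] := cD.
exists (fun n => xget 0 [set x | D x /\ f x = n]) => z zb.
apply: nrm_eq0; apply/eqP; rewrite eq_le nrm_ge0 andbT leNgt; apply/negP => z0.
have z0C : 0 < (nrm z)%:C by rewrite ltcR.
have [y [yb yD]] : (ball z (nrm z)%:C `&` D) !=set0.
  by apply: dD; [exists z; exact: ballxx|exact: ball_open].
have zy : '[z, y] = 0.
  have := zb (f y); case: xgetP => [_ -> [xD fx]|/(_ y)]; last by case.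
  by rewrite (fi _ _ _ _ fx) ?inE.
have h : nrm (z - y) < nrm z by move: yb; rewrite -ball_normE /= nrmE ltcR.
have := cauchy_schwarz z (z - y).
rewrite dotBr zy subr0 dotxx // cabsR ger0_norm ?exprn_ge0 ?nrm_ge0 //.
by rewrite expr2 ler_pM2l // leNgt h.
Qed.

(** Apply [double_paths] separately to the even and to the odd levels, and use the
    same index (p, i) for the i-th even and the i-th odd vertex of the path p. *)
Lemma four_projections : separable H ->
  exists (a1 a2 a3 a4 : R) (P1 P2 P3 P4 : H -> H),
    [/\ proj P1, proj P2, proj P3 & proj P4] /\
    forall z, A z = a1%:C *: P1 z + a2%:C *: P2 z + a3%:C *: P3 z + a4%:C *: P4 z.
Proof.
move=> /dense_seq[b btot]; have [c [lev [lev2 von vA vc vtot]]] := tower b.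
have two_colour_paths (p : bool) : exists psi : nat * int -> nat * nat, [/\ injective psi,
    forall k, in_tower lev (psi k) /\ odd (psi k).1 = p,
    forall v, in_tower lev v -> odd v.1 = p -> exists k, psi k = v &
    forall n i, i != 0 -> (psi (n, i)).2 = 0].
  (* the j-th vector of the n-th level of parity p *)
  pose h j n : nat * nat := (p + n.*2, j)%N.
  have hi j : injective (h j) by move=> m n [] /addnI/double_inj.
  have hp j n : odd (h j n).1 = p by rewrite oddD oddb odd_double addbF.
  have [|||psi [pi pBG psurj pG]] := @double_paths
    [set v | [/\ in_tower lev v, odd v.1 = p & (0 < v.2)%N]]
    [set v | [/\ in_tower lev v, odd v.1 = p & v.2 = 0]].
  - apply: (infinite_set_inj_seq (hi 1%N)) => n; split=> //; exact: lev2.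
  - apply: (infinite_set_inj_seq (hi 0%N)) => n; split=> //; exact: ltnW (lev2 _).
  - by move=> v [_ _ +] [_ _ e]; rewrite e.
  exists psi; split=> //.
  - by move=> k; case: (pBG k) => -[].
  - move=> v vv vp; apply: psurj; case: (posnP v.2) => e; first by right.
    by left.
  - by move=> n i /(pG n)[].
have [psx [xi xv xs xg]] := two_colour_paths false.
have [psy [yi yv ys yg]] := two_colour_paths true.
pose x k := tower_vec lev (psx k); pose y k := tower_vec lev (psy k).
pose dx k := qform (x k) - c; pose dy k := qform (y k) - c.
have xon : orthonormal_family x.
  by move=> i j; rewrite von ?(inj_eq xi) //; have [] := xv i; have [] := xv j.
have yon : orthonormal_family y.
  by move=> i j; rewrite von ?(inj_eq yi) //; have [] := yv i; have [] := yv j.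
have xy i j : '[x i, y j] = 0.
  have [vi pi] := xv i; have [vj pj] := yv j; rewrite von //.
  by case: eqP => // e; move: pi; rewrite e pj.
have Ax i j : '[A (x i), x j] = (i == j)%:R * (c + dx i)%:C.
  case: eqVneq => [<-|ij]; first by rewrite mul1r /dx addrC subrK qformE.
  have [vi pi] := xv i; have [vj pj] := xv j.
  by rewrite mul0r vA ?(inj_eq xi) // pi pj.
have Ay i j : '[A (y i), y j] = (i == j)%:R * (c + dy i)%:C.
  case: eqVneq => [<-|ij]; first by rewrite mul1r /dy addrC subrK qformE.
  have [vi pi] := yv i; have [vj pj] := yv j.
  by rewrite mul0r vA ?(inj_eq yi) // pi pj.
have D0 : 0 <= `|M| + `|c| by rewrite addr_ge0.
have qD u : '[u, u] = 1 -> `|qform u - c| <= `|M| + `|c|.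
  move=> u1; apply: le_trans (ler_normB _ _) _; apply: lerD => //.
  apply: le_trans (qform_bound u1) _; exact: ler_norm.
have good (ps : nat * int -> nat * nat) n i : (forall n i, i != 0 -> (ps (n, i)).2 = 0%N) ->
    i != 0 -> `|qform (tower_vec lev (ps (n, i))) - c| <= 2^-1 ^+ (ps (n, i)).1.
  move=> pg i0; have := vc (ps (n, i)).1; have := pg n i i0.
  by case: (ps (n, i)) => [? ?] /= ->.
have inj (ps : nat * int -> nat * nat) n i j : injective ps ->
    (forall n i, i != 0 -> (ps (n, i)).2 = 0%N) ->
    i != 0 -> j != 0 -> (ps (n, i)).1 = (ps (n, j)).1 -> i = j.
  move=> pi pg i0 j0 e; have [] // : (n, i) = (n, j).
  apply: pi; have := pg n i i0; have := pg n j j0.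
  by case: (ps (n, i)) (ps (n, j)) e => [? ?] [? ?] /= -> -> ->.
have x1 k : '[x k, x k] = 1 by rewrite xon eqxx.
have y1 k : '[y k, y k] = 1 by rewrite yon eqxx.
have [K [zeta [xi' [dxE dyE zK xK]]]] := @bounded_walk R dx dy
  (fun k => (psx k).1) (fun k => (psy k).1) _ D0
  (fun k => qD _ (x1 k)) (fun k => qD _ (y1 k))
  (fun n i => good psx n i xg) (fun n i => good psy n i yg)
  (fun n i j => inj psx n i j xi xg) (fun n i j => inj psy n i j yi yg).
apply: (@four_proj_of_paths _ x y (fun k => (k.1, k.2 + 1))
  (fun k => (k.1, k.2 - 1)) A M c K dx dy zeta xi') => //.
- move=> z zx zy; apply: btot => n; apply: vtot => v vv.
  case p : (odd v.1); first by have [k <-] := ys v vv p; exact: zy.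
  by have [k <-] := xs v vv p; exact: zx.
- by move=> [n i] /=; rewrite addrK.
- by move=> [n i] /=; rewrite subrK.
Qed.

End Tower.
End HilbertSpace.

(** * The decomposition *)

(** Linearity and boundedness are consequences of self-adjointness and idempotency. *)
Lemma linear_of_proj (R : realType) (H : completeNormedModType R[i])
    (dot : {dot H for @Num.conj R[i]}) (P : H -> H) :
  induces_norm dot -> proj dot P ->
  exists2 T : {linear H -> H}, orthoprojection dot T & forall x, T x = P x.
Proof.
move=> Hdot pP; have [sP PP] := pP.
have lP : linear P by move=> a x y; rewrite (selfadjD _ _ sP) (selfadjZ _ _ sP).
pose T : {linear H -> H} := HB.pack P (GRing.isLinear.Build _ _ _ _ P lP).
exists T => //; split=> //.
by exists 1 => x; rewrite !nrmE -rmorphM lecR; exact: (proj_contraction Hdot pP).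
Qed.

Theorem theorem3p1 (R : realType) (H : completeNormedModType R[i])
    (dot : {dot H for @Num.conj R[i]}) (Hdot : induces_norm dot)
    (Hsep : separable H) (Hinf : ~ finite_dimensional H)
    (A : {linear H -> H}) (Abnd : bounded_operator A)
    (Asa : self_adjoint dot A) :
  exists (alpha1 alpha2 alpha3 alpha4 : R) (P1 P2 P3 P4 : {linear H -> H}),
    [/\ orthoprojection dot P1, orthoprojection dot P2,
        orthoprojection dot P3 & orthoprojection dot P4] /\
    forall x : H,
      A x = alpha1%:C *: P1 x + alpha2%:C *: P2 x
            + alpha3%:C *: P3 x + alpha4%:C *: P4 x.
Proof.
have [M AM] := Abnd.
have bA : bounded_by M A by move=> x; have := AM x; rewrite !nrmE -rmorphM lecR.
have [a1 [a2 [a3 [a4 [P1 [P2 [P3 [P4 [[p1 p2 p3 p4] AE]]]]]]]]] :=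
  four_projections Hdot Hinf Asa bA Hsep.
have [T1 o1 E1] := linear_of_proj Hdot p1; have [T2 o2 E2] := linear_of_proj Hdot p2.
have [T3 o3 E3] := linear_of_proj Hdot p3; have [T4 o4 E4] := linear_of_proj Hdot p4.
exists a1, a2, a3, a4, T1, T2, T3, T4; split=> // x.
by rewrite E1 E2 E3 E4 AE.
Qed.
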